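(* Let $n\ge 1$ be an odd integer and $q=2^n$. If $n\geq 3$, then $\Phi''_{24}:=q^2-q\sqrt{2q}+q-\sqrt{2q}+1$ is divisible by a primitive prime divisor $\mathrm{ppd}(2,12n)$ (of $q^4-q^2+1$). In all cases, $\Phi'_{24}:=q^2+q\sqrt{2q}+q+\sqrt{2q}+1$ is divisible by a primitive prime divisor $\mathrm{ppd}(2,12n)$ (of $q^4-q^2+1$).
   Context: For integers $a,m\geq 2$, a primitive prime divisor $\mathrm{ppd}(a,m)$ is a prime divisor of $a^m-1$ that does not divide $\prod_{j=1}^{m-1}(a^j-1)$. Note $q^4-q^2+1=\Phi'_{24}\Phi''_{24}$, and both factors are integers since $n$ is odd. *)

(* Defs.v *)
(* Written against the Mathematical Components library. *)
From HB Require Import structures.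
From mathcomp Require Import all_boot all_order all_algebra.

Set Implicit Arguments.
Unset Strict Implicit.
Unset Printing Implicit Defensive.

Import Order.TTheory GRing.Theory Num.Theory.

Local Open Scope ring_scope.

(* Meant for 2 <= a and 2 <= m; then a ^ j >= 1, so the truncated
   subtraction on nat is the ordinary one. *)
Definition is_ppd (a m p : nat) : bool :=
  [&& prime p,
      (p %| a ^ m - 1)%N
    & ~~ (p %| \prod_(1 <= j < m) (a ^ j - 1))%N].

Definition Phi24' (R : rcfType) (q : nat) : R :=
  let r := Num.sqrt (2 * q%:R) in
  q%:R ^+ 2 + q%:R * r + q%:R + r + 1.

Definition Phi24'' (R : rcfType) (q : nat) : R :=
  let r := Num.sqrt (2 * q%:R) in
  q%:R ^+ 2 - q%:R * r + q%:R - r + 1.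

(* x is the image in R of an integer multiple of p. Divisibility is taken
   in the integers because in the field R it would be trivial. *)
Definition dvd_as_int (R : rcfType) (p : nat) (x : R) : Prop :=
  exists2 z : int, x = z%:~R & (p %| z)%Z.

(* Main.v *)
Require Import Defs.
From HB Require Import structures.
From mathcomp Require Import all_boot all_order all_algebra.
From mathcomp Require Import ring lra zify.

Set Implicit Arguments.
Unset Strict Implicit.
Unset Printing Implicit Defensive.

Import Order.TTheory GRing.Theory Num.Theory.

Local Open Scope ring_scope.

(** Put s = sqrt 2 and y = s ^ n, so that q = y ^ 2 and sqrt (2 q) = s y. The two
    factors of q ^ 4 - q ^ 2 + 1 are then F (y) and F (- y) for the polynomial
    F (Y) = Y ^ 4 + s Y ^ 3 + Y ^ 2 + s Y + 1, whose roots are four of the eight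
    primitive 24th roots of unity. Thus F and F (- Y) behave like cyclotomic
    polynomials over Q(sqrt 2), and Zsigmondy's argument can be run on each of
    them separately.

    Write A e d for the factor of sign e at the exponent d. If l > 3 is prime,
    then A e (l d) is divisible by A e' d, where e' is e twisted by the Jacobi
    symbol (2 / l); a prime p dividing A e' d divides A e (l d) to the same power,
    except for one more when p = l ([dvdn_aurifeuille_mul],
    [dvdn_aurifeuille_div], [logn_aurifeuille_mul]). Let L be the list of the
    primes l > 3 dividing n, and take the product of the A e_T (n / prod T) to the
    power (-1) ^ |T| over all sublists T of L. Its p-adic valuation telescopes
    ([logn_mobius_frac]): all prime divisors of A e n cancel, except the primitive
    ones and possibly the largest prime of L, the latter to the first power only.
    The prime 3 is left out because the order of 2 modulo a divisor of A e n is
    always divisible by the full power of 3 dividing 3 n.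

    So if A e n had no primitive prime divisor, the product would be at most
    max L ([mobius_frac_dvdn]). But it is too large for that. The product is a
    rational function of y, and from (y - 1) ^ 4 <= A e d <= (y + 1) ^ 4 induction
    on L gives bounds (y - 1) ^ D and (y + 1) ^ D, those of a product of D
    factors y - w with |w| = 1. Peeling off the prime l = max L alone then shows
    that the product is at least ((y ^ l - 1) / (y + 1)) ^ 4 > l
    ([mobius_frac_gt]). If L is empty, all prime divisors of A e n are primitive,
    and A e n > 1 except for the minus sign and n = 1. *)

(** * Prime powers in geometric sums *)

Lemma geometric_sum_mod_sqr z l :
  exists c, (\sum_(i < l) z.+1 ^ i = l + 'C(l, 2) * z + c * z ^ 2)%N.
Proof.
have pow i : exists c, (z.+1 ^ i = 1 + i * z + c * z ^ 2)%N.
  elim: i => [|i [c IH]]; first by exists 0%N.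
  by exists (i + c + c * z)%N; rewrite expnS IH; ring.
elim: l => [|l [c IH]]; first by exists 0%N; rewrite big_ord0.
have [c' Hc'] := pow l.
exists (c + c')%N; rewrite big_ord_recr /= IH Hc' binS bin1; ring.
Qed.

(** The case of a prime exponent of the lifting-the-exponent lemma; for l = p
    it rests on p dividing 'C(p, 2), hence on p being odd. *)
Lemma logn_subn1_exp_prime p x l :
    prime p -> odd p -> prime l -> (1 < x)%N -> (p %| x - 1)%N ->
  logn p (x ^ l - 1) = (logn p (x - 1) + logn p l)%N.
Proof.
move=> p_pr p_odd l_pr; case: x => // z z_gt0; rewrite subn1 /= => p_z.
rewrite subn1 predn_exp /= lognM //; last first.
  by case: l l_pr => // l _; rewrite big_ord_recl.
congr addn.
have [c ->] := geometric_sum_mod_sqr z l.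
have /dvdnP[z' Dz] := p_z.
have p_gt0 := prime_gt0 p_pr.
rewrite (logn_prime _ l_pr); have [Dl|ne_pl] := eqVneq p l; last first.
  rewrite logn_coprime // prime_coprime // -addnA dvdn_addl; last first.
    by rewrite Dz; apply/dvdnP; exists ('C(l, 2) * z' + c * z' * (z' * p))%N; ring.
  by rewrite dvdn_prime2.
have /dvdnP[b Db] : (p %| 'C(l, 2))%N.
  rewrite -Dl prime_dvd_bin //=.
  have := prime_gt1 p_pr; case: (p) p_odd => [|[|[|]]] //.
have ->: (l + 'C(l, 2) * z + c * z ^ 2 = p * (1 + p * (b * z' + c * z' ^ 2)))%N.
  by rewrite Db Dz -Dl; ring.
rewrite lognM // logn_prime // eqxx logn_coprime ?addn0 //.
by rewrite prime_coprime // dvdn_addl ?dvdn_mulr // Euclid_dvd1.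
Qed.

(** Carrying the order of 2 as a natural number with its divisibility property
    keeps it free of the type 'F_p, which depends on p. *)
Lemma order2_exists p : prime p -> odd p ->
  exists2 o, (0 < o < p)%N & forall m, (p %| 2 ^ m - 1)%N = (o %| m)%N.
Proof.
move=> p_pr p_odd.
have p_gt1 := prime_gt1 p_pr.
have dvdE m : (p %| 2 ^ m - 1)%N = (2 ^ m == 1 %[mod p])%N.
  by rewrite eqn_mod_dvd ?expn_gt0.
have co k : coprime p (2 ^ k).
  by rewrite coprimeXr // coprimen2.
pose P m := (0 < m)%N && (p %| 2 ^ m - 1)%N.
have p1P : P p.-1.
  rewrite /P -subn1 subn_gt0 p_gt1 /= -(Gauss_dvdr _ (co 1%N)).
  rewrite mulnBr -expnD addnC subnK ?prime_gt0 // muln1.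
  by rewrite -eqn_mod_dvd ?fermat_little // (leq_pexp2l (n1 := 1)) ?prime_gt0.
have exP : exists m, P m by exists p.-1.
have [o /andP[o_gt0 po] o_min] := ex_minnP exP.
exists o; first by rewrite o_gt0 (leq_ltn_trans (o_min _ p1P)) ?prednK ?prime_gt0.
move=> m; have ->: (p %| 2 ^ m - 1 = (p %| 2 ^ (m %% o) - 1))%N.
  rewrite !dvdE {1}(divn_eq m o) expnD [X in (2 ^ X)%N]mulnC expnM.
  by rewrite -modnMml -modnXm (eqP (etrans (esym (dvdE o)) po)) modnXm exp1n
    modnMml mul1n.
have [mo0 | nz] := posnP (m %% o)%N; first by rewrite mo0 subnn dvdn0 /dvdn mo0.
rewrite [RHS]/dvdn (gtn_eqF nz); apply/negP => p_m.
have /o_min : P (m %% o)%N by rewrite /P nz.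
by rewrite leqNgt ltn_mod o_gt0.
Qed.

(** * The Aurifeuillian factors *)

(** [aurifeuille true d] and [aurifeuille false d] are the two factors of
    q ^ 4 - q ^ 2 + 1 at q = 2 ^ d, for odd d. *)
Definition aurifeuille (e : bool) (d : nat) : nat :=
  if e then ((2 ^ d).+1 * (2 ^ d + 2 ^ uphalf d)).+1
  else ((2 ^ d).+1 * (2 ^ d - 2 ^ uphalf d)).+1.

Definition aurifeuille_form (K : pzRingType) (e : bool) (q r : K) : K :=
  (q + 1) * (q + (-1) ^+ (~~ e) * r) + 1.

(** The Jacobi symbol (2 / l), as the bit that is set when it is -1. *)
Definition two_nonresidue (l : nat) : bool :=
  (l %% 8 == 3)%N || (l %% 8 == 5)%N.

Lemma aurifeuille_gt0 e d : (0 < aurifeuille e d)%N.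
Proof. by case: e. Qed.

Lemma aurifeuille_natr (K : pzRingType) e d : odd d ->
  (aurifeuille e d)%:R =
    aurifeuille_form e (2 ^+ d) (2 ^+ uphalf d) :> K.
Proof.
move=> d_odd; rewrite /aurifeuille /aurifeuille_form.
have le : (2 ^ uphalf d <= 2 ^ d)%N by rewrite leq_exp2l //; lia.
case: e; rewrite -addn1 natrD natrM -addn1 natrD ?natrD ?natrB // !natrX /=.
  by rewrite expr0 mul1r.
by rewrite expr1 mulN1r.
Qed.

Lemma sqr_exp2_uphalf (K : pzRingType) d : odd d ->
  (2 ^+ uphalf d) ^+ 2 = 2 * 2 ^+ d :> K.
Proof. by move=> d_odd; rewrite -exprM -exprS; congr (_ ^+ _); lia. Qed.

Section Forms.
Variable K : comPzRingType.
Implicit Types (q r : K) (e : bool).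

Lemma aurifeuille_form_mul e q r : r ^+ 2 = 2 * q ->
  aurifeuille_form e q r * aurifeuille_form (~~ e) q r = q ^+ 4 - q ^+ 2 + 1.
Proof. by rewrite /aurifeuille_form; case: e => /= H; ring: H. Qed.

(** With q = zeta ^ 2 for a root of unity zeta of order 24, the roots of the
    two forms are r = - (q ^ 2 + q ^-1) and r = q ^ 2 + q ^-1, because
    sqrt 2 = zeta ^ 3 + zeta ^-3. *)
Lemma aurifeuille_form_root e q r :
    r ^+ 2 = 2 * q -> aurifeuille_form e q r = 0 ->
  r = - (-1) ^+ (~~ e) * (q ^+ 2 - q ^+ 3 + q).
Proof.
move=> Dr root_e.
have q4 : q ^+ 4 = q ^+ 2 - 1.
  have := aurifeuille_form_mul e Dr; rewrite root_e mul0r => /esym H.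
  by apply/eqP; rewrite -subr_eq0 -H; apply/eqP; ring.
have Er : (q + 1) * r = - (-1) ^+ (~~ e) * (q ^+ 2 + q + 1).
  move: root_e; rewrite /aurifeuille_form; case: e => /= H.
    have {}H : q * r = - (q ^+ 2 + q + r + 1) by rewrite -[LHS]addr0 -oppr0 -H; ring.
    by ring: H.
  have {}H : q * r = q ^+ 2 + q - r + 1 by rewrite -[LHS]addr0 -H; ring.
  by ring: H.
have inv_q1 : (q ^+ 2 - q ^+ 3) * (q + 1) = 1 by ring: q4.
have -> : r = (q ^+ 2 - q ^+ 3) * ((q + 1) * r) by rewrite mulrA inv_q1 mul1r.
by rewrite Er; ring: q4.
Qed.

(** Raising zeta to an odd power l prime to 3 permutes the roots of order 24
    and multiplies sqrt 2 = zeta ^ 3 + zeta ^-3 by the symbol (2 / l). As the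
    powers of q have period 12, this is a check over the residues of k. *)
Lemma aurifeuille_form_odd_power e q r k :
    r ^+ 2 = 2 * q -> ~~ (3 %| k.*2.+1)%N ->
    aurifeuille_form (e (+) two_nonresidue k.*2.+1) q r = 0 ->
  aurifeuille_form e (q ^+ k.*2.+1) (q ^+ k * r) = 0.
Proof.
move=> Dr k3 root_e.
have q4 : q ^+ 4 = q ^+ 2 - 1.
  have := aurifeuille_form_mul (e (+) two_nonresidue k.*2.+1) Dr.
  rewrite root_e mul0r => H.
  by apply/eqP; rewrite -subr_eq0 H; apply/eqP; ring.
have q12 : q ^+ 12 = 1 by ring: q4.
rewrite (aurifeuille_form_root Dr root_e) {root_e Dr}.
have Ek : q ^+ k = q ^+ (k %% 12)%N by rewrite [RHS]expr_mod.
have Ek2 : q ^+ k.*2.+1 = q ^+ (k %% 12).*2.+1%N.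
  by rewrite -[LHS](expr_mod _ q12) -[RHS](expr_mod _ q12); congr (_ ^+ _); lia.
have Et : two_nonresidue k.*2.+1 = two_nonresidue (k %% 12)%N.*2.+1.
  rewrite /two_nonresidue (_ : k.*2.+1 %% 8 = (k %% 12).*2.+1 %% 8)%N //; lia.
have {}k3 : ~~ (3 %| (k %% 12)%N.*2.+1)%N by apply: contra k3; lia.
rewrite Ek Ek2 Et /aurifeuille_form.
have: (k %% 12 < 12)%N by rewrite ltn_mod.
move: (k %% 12)%N k3 => {Ek Ek2 Et}.
by do 12?[case=> //=]; case: e => /= _ _; ring: q4.
Qed.
End Forms.

(** * Prime divisors of the factors *)

Lemma odd_aurifeuille e d : odd d -> odd (aurifeuille e d).
Proof.
move=> d_odd; have d_gt0 : (0 < d)%N by case: d d_odd.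
have even2 i : (0 < i)%N -> odd (2 ^ i) = false.
  by move=> i_gt0; rewrite oddX /= orbF; case: i i_gt0.
have h_gt0 : (0 < uphalf d)%N by lia.
case: e; rewrite /= oddM ?oddD ?oddB /= ?even2 // leq_exp2l //; lia.
Qed.

Section PrimeDivisors.
Variables (p : nat) (p_pr : prime p).
Let charp := pchar_Fp p_pr.

Lemma dvdn_aurifeuille e d : odd d ->
  (p %| aurifeuille e d)%N =
    (aurifeuille_form e (2 ^+ d) (2 ^+ uphalf d) == 0 :> 'F_p).
Proof. by move=> d_odd; rewrite (dvdn_pcharf charp) aurifeuille_natr. Qed.

Lemma dvdn_exp2_subn1 m : (p %| 2 ^ m - 1)%N = (2 ^+ m == 1 :> 'F_p).
Proof.
by rewrite (dvdn_pcharf charp) natrB ?expn_gt0 // natrX subr_eq0.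
Qed.

Section Root.
Variables (e : bool) (d : nat).
Hypotheses (d_odd : odd d) (p_e : (p %| aurifeuille e d)%N).
Let q : 'F_p := 2 ^+ d.

Lemma aurifeuille_p_odd : odd p.
Proof. exact: dvdn_odd p_e (odd_aurifeuille e d_odd). Qed.

Lemma aurifeuille_q4 : q ^+ 4 = q ^+ 2 - 1.
Proof.
have /eqP root_e := etrans (esym (dvdn_aurifeuille e d_odd)) p_e.
have := aurifeuille_form_mul e (sqr_exp2_uphalf 'F_p d_odd).
rewrite root_e mul0r -/q => H.
by apply/eqP; rewrite -subr_eq0 H; apply/eqP; ring.
Qed.

Lemma aurifeuille_nat_neq0 (m : nat) :
  m \in [:: 2; 3] -> m%:R != 0 :> 'F_p.
Proof.
have q4 := aurifeuille_q4.
move=> m23; rewrite -(dvdn_pcharf charp).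
have m_pr : prime m by move: m23; rewrite !inE => /orP[]/eqP->.
rewrite dvdn_prime2 //.
apply/eqP=> Dp; move: m23; rewrite !inE -Dp => /orP[]/eqP p_val.
  by have := aurifeuille_p_odd; rewrite p_val.
have n3 : 3 = 0 :> 'F_p by apply/eqP; rewrite -(dvdn_pcharf charp 3) p_val.
have q1 : q = -1.
  have -> : q = (-1) ^+ d by congr (_ ^+ d); apply/eqP; rewrite -addr_eq0 natr1 n3.
  by rewrite -signr_odd d_odd.
by move/eqP: q4; rewrite q1 -signr_odd sqrrN expr1n subrr expr0 oner_eq0.
Qed.

(** A common prime divisor of the two factors divides half their sum, which is
    q ^ 2 + q + 1; together with q ^ 4 = q ^ 2 - 1 this forces q = -1, and then
    q ^ 2 + q + 1 = 1. *)
Lemma aurifeuille_conjugate_ndvd : ~~ (p %| aurifeuille (~~ e) d)%N.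
Proof.
have q4 := aurifeuille_q4; have n2 := @aurifeuille_nat_neq0 2 isT.
move: p_e; rewrite !dvdn_aurifeuille // -/q => /eqP root_e.
apply/eqP=> root_Ne.
have q2 : q ^+ 2 = - q - 1.
  have : 2 * (q ^+ 2 + q + 1) = 0.
    rewrite -[RHS]addr0 -{1}root_e -root_Ne /aurifeuille_form.
    by case: (e) => /=; ring.
  move/eqP; rewrite mulf_eq0 (negPf n2) /= => /eqP H.
  by rewrite -[RHS]addr0 -H; ring.
have q1 : q = -1.
  have : 2 * (q + 1) = 0.
    have q4' : q ^+ 4 = q by ring: q2.
    by move: q4; rewrite q4' q2 => H; rewrite mulrDr mulr_natl mulr2n {1}H; ring.
  by move/eqP; rewrite mulf_eq0 (negPf n2) /= addr_eq0 => /eqP.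
by move/eqP: q2; rewrite q1 expr2 mulrNN mulr1 opprK subrr oner_eq0.
Qed.

Lemma aurifeuille_q6 : q ^+ 6 = -1.
Proof. by have q4 := aurifeuille_q4; ring: q4. Qed.

Lemma dvdn_exp2_12 : (p %| 2 ^ (12 * d) - 1)%N.
Proof.
have q6 := aurifeuille_q6.
rewrite dvdn_exp2_subn1 mulnC exprM -/q.
by rewrite (exprM q 6 2) q6 sqrrN expr1n.
Qed.

Lemma dvdn_exp2_6F : (p %| 2 ^ (6 * d) - 1)%N = false.
Proof.
have n2 := @aurifeuille_nat_neq0 2 isT.
rewrite dvdn_exp2_subn1 mulnC exprM -/q aurifeuille_q6.
by apply/eqP=> H; case/eqP: n2; rewrite mulr2n -{1}H addNr.
Qed.

Lemma dvdn_exp2_4F : (p %| 2 ^ (4 * d) - 1)%N = false.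
Proof.
have n3 := @aurifeuille_nat_neq0 3 isT; have q4 := aurifeuille_q4.
rewrite dvdn_exp2_subn1 mulnC exprM -/q.
apply/eqP=> H; case/eqP: n3.
have q2 : q ^+ 2 = 2 by move: q4; rewrite H => /esym/eqP; rewrite subr_eq => /eqP.
move: H; rewrite (exprM q 2 2) q2 => /eqP; rewrite -subr_eq0 => /eqP <-.
by ring.
Qed.

(** 2 ^ (12 d) - 1 is the product of the two factors, of q ^ 2 + 1 and of
    q ^ 6 - 1, and p divides only one of these four numbers. *)
Lemma logn_aurifeuille :
  logn p (aurifeuille e d) = logn p (2 ^ (12 * d) - 1).
Proof.
have d_gt0 : (0 < d)%N by case: (d) d_odd.
have prod : (2 ^ (12 * d) - 1 = aurifeuille e d *
    (aurifeuille (~~ e) d * (((2 ^ d) ^ 2).+1 * (2 ^ (6 * d) - 1))))%N.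
  apply/eqP; rewrite -(eqr_nat int) !natrM !natrB ?expn_gt0 //.
  have D := aurifeuille_form_mul e (sqr_exp2_uphalf int d_odd).
  rewrite !aurifeuille_natr // mulrA D -(natr1 ((2 ^ d) ^ 2)%N) !natrX.
  by rewrite [(12 * d)%N]mulnC [(6 * d)%N]mulnC !exprM; apply/eqP; ring.
have pos m : (0 < m)%N -> (0 < 2 ^ (m * d) - 1)%N.
  by move=> m_gt0; rewrite subn_gt0 -{1}(expn0 2) ltn_exp2l // muln_gt0 m_gt0.
rewrite prod lognM ?muln_gt0 ?aurifeuille_gt0 ?pos //.
rewrite [X in (_ + X)%N]logn_coprime ?addn0 //.
rewrite prime_coprime // !Euclid_dvdM // negb_or aurifeuille_conjugate_ndvd /=.
rewrite dvdn_exp2_6F orbF (dvdn_pcharf charp) -natr1 !natrX -/q.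
apply/eqP=> H; case/negP: (@aurifeuille_nat_neq0 3 isT).
have q2 : q ^+ 2 = -1 by apply/eqP; rewrite -addr_eq0 H.
have := aurifeuille_q4; rewrite (exprM q 2 2) q2 => /eqP; rewrite -subr_eq0.
by rewrite (_ : _ - _ = 3%:R :> 'F_p) //; ring.
Qed.

End Root.

Lemma dvdn_aurifeuille_mul e d l :
    odd d -> odd l -> coprime 3 l ->
    (p %| aurifeuille (e (+) two_nonresidue l) d)%N ->
  (p %| aurifeuille e (l * d))%N.
Proof.
move=> d_odd l_odd l3; have ld_odd : odd (l * d) by rewrite oddM l_odd.
have Dl : l = l./2.*2.+1 by lia.
rewrite !dvdn_aurifeuille // => /eqP H; apply/eqP.
have -> : 2 ^+ uphalf (l * d) = (2 ^+ d) ^+ l./2 * 2 ^+ uphalf d :> 'F_p.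
  rewrite -exprM -exprD; congr (_ ^+ _).
  have -> : uphalf d = (d./2).+1 by lia.
  have Dd : d = d./2.*2.+1 by lia.
  rewrite {1}Dl {1 3}Dd; set a := l./2; set b := d./2.
  have ->: (a.*2.+1 * b.*2.+1 = (a * b.*2.+1 + b).*2.+1)%N by nia.
  lia.
have := @aurifeuille_form_odd_power 'F_p e (2 ^+ d) (2 ^+ uphalf d) l./2.
rewrite -Dl (mulnC l d) exprM; apply=> //; first exact: sqr_exp2_uphalf.
by rewrite -prime_coprime.
Qed.

(** The converse holds once the order of 2 divides 12 d: then p divides one of
    the two factors at d, and the wrong one would put p in both factors at
    l d. *)
Lemma dvdn_aurifeuille_div e d l :
    odd d -> odd l -> coprime 3 l -> (p %| 2 ^ (12 * d) - 1)%N ->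
  (p %| aurifeuille e (l * d))%N = (p %| aurifeuille (e (+) two_nonresidue l) d)%N.
Proof.
move=> d_odd l_odd l3 q12; have ld_odd : odd (l * d) by rewrite oddM l_odd.
apply/idP/idP; last exact: dvdn_aurifeuille_mul.
move=> p_ld; set e' := _ (+) _.
suff /orP[//|p_wrong] : (p %| aurifeuille e' d)%N || (p %| aurifeuille (~~ e') d)%N.
  have /negP[] := aurifeuille_conjugate_ndvd ld_odd p_ld.
  by apply: dvdn_aurifeuille_mul => //; move: p_wrong; rewrite /e' addNb.
rewrite !dvdn_aurifeuille // -mulf_eq0 aurifeuille_form_mul ?sqr_exp2_uphalf //.
move: q12; rewrite dvdn_exp2_subn1 mulnC exprM; set q := 2 ^+ d => /eqP q12.
have := aurifeuille_q4 ld_odd p_ld; rewrite mulnC exprM -/q => q4.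
have l12 : (l %% 12 \in [:: 1; 5; 7; 11])%N.
  move: l3; rewrite prime_coprime // (_ : (3 %| l) = (3 %| l %% 12))%N; last lia.
  have : odd (l %% 12) by lia.
  have : (l %% 12 < 12)%N by rewrite ltn_mod.
  by move: (l %% 12)%N; do 12?[case=> //].
(* As l ^ 2 = 1 modulo 12, q is a power of q ^ l and inherits its equation. *)
have Eq : (q ^+ l) ^+ l = q.
  rewrite -exprM -(expr_mod _ q12) (_ : l * l %% 12 = 1)%N //.
  by rewrite -modnMm; move: l12; rewrite !inE => /or4P[] /eqP->.
have x12 : (q ^+ l) ^+ 12 = 1 by move: q4; move: (q ^+ l) => x x4; ring: x4.
rewrite -[q in q ^+ 4]Eq -[q in q ^+ 2]Eq -[(q ^+ l) ^+ l](expr_mod _ x12).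
move: q4; move: (q ^+ l) => x x4.
by move: l12; rewrite !inE => /or4P[] /eqP->; apply/eqP; ring: x4.
Qed.
End PrimeDivisors.

Lemma prime_gt3_odd l : prime l && (3 < l)%N -> odd l.
Proof. by case/andP=> l_pr; case: (even_prime l_pr) => [->|]. Qed.

Lemma prime_gt3_coprime3 l : prime l -> (3 < l)%N -> coprime 3 l.
Proof. by move=> l_pr l_gt3; rewrite prime_coprime // dvdn_prime2 // ltn_eqF. Qed.

(** Lifting the exponent for 2 ^ (12 d) - 1, which has the same p-part as the
    factor. *)
Lemma logn_aurifeuille_mul p e d l :
    prime p -> odd d -> prime l -> (3 < l)%N ->
    (p %| aurifeuille (e (+) two_nonresidue l) d)%N ->
  logn p (aurifeuille e (l * d)) =
    (logn p (aurifeuille (e (+) two_nonresidue l) d) + logn p l)%N.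
Proof.
move=> p_pr d_odd l_pr l_gt3 p_d.
have d_gt0 : (0 < d)%N by case: d d_odd {p_d}.
have l_odd : odd l by apply: prime_gt3_odd; rewrite l_pr.
have l3 := prime_gt3_coprime3 l_pr l_gt3.
have p_ld := dvdn_aurifeuille_mul p_pr d_odd l_odd l3 p_d.
rewrite (logn_aurifeuille p_pr d_odd p_d).
rewrite (logn_aurifeuille p_pr _ p_ld) ?oddM ?l_odd // mulnCA [(l * _)%N]mulnC expnM.
apply: logn_subn1_exp_prime => //.
- exact: (aurifeuille_p_odd d_odd p_d).
- by rewrite -{1}(expn0 2) ltn_exp2l // muln_gt0.
- exact: (dvdn_exp2_12 p_pr d_odd p_d).
Qed.

(** * The Moebius product *)

Lemma dvdn_logn m n : (0 < m)%N -> (0 < n)%N ->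
  (forall l, prime l -> (logn l m <= logn l n)%N) -> (m %| n)%N.
Proof.
move=> m_gt0 n_gt0 le_mn; apply/dvdn_partP=> // l l_m.
have l_pr : prime l by move: l_m; rewrite mem_primes; case/andP.
by rewrite p_part pfactor_dvdn // le_mn.
Qed.

Lemma dvdn_cancel_prime l o k : prime l -> (0 < k)%N ->
  (o %| l * k)%N -> (logn l o <= logn l k)%N -> (o %| k)%N.
Proof.
move=> l_pr k_gt0 o_lk le_ok.
have lk_gt0 : (0 < l * k)%N by rewrite muln_gt0 prime_gt0.
apply: dvdn_logn => // [|r r_pr]; first exact: dvdn_gt0 o_lk.
have [->//|ne_rl] := eqVneq r l.
have := dvdn_leq_log r lk_gt0 o_lk.
by rewrite (lognM _ (prime_gt0 l_pr) k_gt0) (logn_prime _ l_pr) (negPf ne_rl).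
Qed.

Lemma prod_primes_gt0 L : all prime L -> (0 < \prod_(i <- L) i)%N.
Proof.
move=> prL; rewrite big_seq; apply: (big_ind (fun m => 0 < m)%N) => // [m1 m2|i iL].
  by rewrite muln_gt0 => -> ->.
exact: prime_gt0 (allP prL _ iL).
Qed.

Lemma prod_odds_odd L : all odd L -> odd (\prod_(i <- L) i).
Proof.
move=> oddL; rewrite big_seq; apply: (big_ind (fun m => odd m)) => // [m1 m2|i iL].
  by rewrite oddM => -> ->.
exact: (allP oddL).
Qed.

Lemma logn_prod_primes L l : uniq L -> all prime L ->
  logn l (\prod_(i <- L) i) = (l \in L).
Proof.
elim: L => [|i L IH] /=; first by rewrite big_nil logn1.
case/andP=> iL uL /andP[i_pr L_pr].
rewrite big_cons (lognM _ (prime_gt0 i_pr)) ?prod_primes_gt0 //.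
rewrite IH // logn_prime // inE.
by have [->|] //= := eqVneq l i; rewrite (negPf iL).
Qed.

(** Numerator ([num = true]) and denominator of the product, over the
    sublists T of L, of the factors [aurifeuille e' (d * prod L / prod T)] to
    the power (-1) ^ |T|, where e' is e twisted by the symbol (2 / prod T). *)
Fixpoint mobius_frac (num : bool) (L : seq nat) (e : bool) (d : nat) : nat :=
  if L is l :: L' then
    (mobius_frac num L' e (l * d) *
     mobius_frac (~~ num) L' (e (+) two_nonresidue l) d)%N
  else if num then aurifeuille e d else 1%N.

Lemma mobius_frac_gt0 num L e d : (0 < mobius_frac num L e d)%N.
Proof.
elim: L num e d => [|l L IH] num e d /=.
  by case: num => //; apply: aurifeuille_gt0.
by rewrite muln_gt0 !IH.
Qed.

Lemma odd_mobius_frac num L e d : all odd L -> odd d ->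
  odd (mobius_frac num L e d).
Proof.
elim: L num e d => [|l L IH] num e d /=.
  by case: num => // _ d_odd; apply: odd_aurifeuille.
by case/andP=> l_odd oddL d_odd; rewrite oddM !IH // oddM l_odd.
Qed.

Section Valuation.
Variables (p o : nat) (p_pr : prime p).
Hypothesis o_bounds : (0 < o < p)%N.
Hypothesis orderP : forall m, (p %| 2 ^ m - 1)%N = (o %| m)%N.

Let local_val (L : seq nat) (e : bool) (d : nat) : nat :=
  if p \in L then nat_of_bool (p %| aurifeuille e d)%N
  else logn p (aurifeuille e d).

Let local_val0 L e d : (p %| aurifeuille e d)%N = false -> local_val L e d = 0%N.
Proof.
by rewrite /local_val => p_e; case: ifP; rewrite ?p_e // lognE p_e !andbF.
Qed.

(** A prime l of L other than p contributes the difference between the exponents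
    l m and m. If the l-part of the order o of 2 already divides d, the two
    valuations agree and cancel; otherwise the one at m is zero and the one at
    l m remains. For l = p the valuation grows by one from m to p m as soon as p
    divides the factor at m, which leaves the indicator of divisibility. *)
Lemma logn_mobius_frac L e d :
    uniq L -> all (fun l => prime l && (3 < l)%N) L -> odd d ->
  logn p (mobius_frac true L e d) =
    (logn p (mobius_frac false L e d) +
     all (fun l => (l == p) || (logn l d < logn l o)%N) L *
       local_val L e (d * \prod_(l <- L) l))%N.
Proof.
have o_gt0 : (0 < o)%N by case/andP: o_bounds.
elim: L e d => [|l L IH] e d /=.
  by move=> *; rewrite big_nil muln1 mul1n logn1.
case/andP=> lL uL /andP[/andP[l_pr l_gt3] prL] d_odd.
have l_odd : odd l by apply: prime_gt3_odd; rewrite l_pr.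
have l3 := prime_gt3_coprime3 l_pr l_gt3.
have d_gt0 : (0 < d)%N by case: (d) d_odd.
rewrite !lognM ?mobius_frac_gt0 // big_cons.
rewrite (IH e (l * d)%N) ?oddM ?l_odd // (IH (e (+) _)) //.
have -> : all (fun i => (i == p) || (logn i (l * d) < logn i o)%N) L =
          all (fun i => (i == p) || (logn i d < logn i o)%N) L.
  apply: eq_in_all => i iL.
  rewrite (lognM _ (prime_gt0 l_pr) d_gt0) (logn_prime _ l_pr).
  by have [Di|] := eqVneq i l; rewrite // -Di iL in lL.
case: (all _ L); last by rewrite andbF !mul0n !addn0.
have pr : all prime L by apply: sub_all prL => i /andP[].
have P_gt0 := prod_primes_gt0 pr.
have P_odd : odd (\prod_(i <- L) i).
  by apply: prod_odds_odd; apply: sub_all prL => i; apply: prime_gt3_odd.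
have logP : logn l (\prod_(i <- L) i) = 0%N.
  by rewrite logn_prod_primes // (negPf lL).
rewrite andbT mul1n mul1n -(mulnA l d) (mulnCA d l).
set P := \prod_(i <- L) i in P_gt0 P_odd logP *; set m := (d * P)%N.
have m_odd : odd m by rewrite oddM d_odd.
have m_gt0 : (0 < m)%N by case: (m) m_odd.
have lm_odd : odd (l * m) by rewrite oddM l_odd.
set e' := _ (+) _.
have log_m : logn l (12 * m) = logn l d.
  rewrite lognM // logn_coprime; last first.
    rewrite (coprimeMr l 3 4) coprime_sym l3; apply: (@coprimeXr 2 l 2).
    by rewrite coprimen2.
  by rewrite /m lognM // logP addn0.
suff -> : local_val L e (l * m) = (local_val L e' m +
    ((l == p) || (logn l d < logn l o)%N) * local_val (l :: L) e (l * m))%N.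
  by ring.
have [Dl | ne_lp] /= := eqVneq l p.
  have pL : (p \in L) = false by rewrite -Dl (negPf lL).
  have -> : local_val (l :: L) e (l * m) = (p %| aurifeuille e (l * m))%N.
    by rewrite /local_val inE Dl eqxx.
  rewrite mul1n; case p_m : (p %| aurifeuille e' m)%N.
    have p_lm : (p %| aurifeuille e (l * m))%N by apply: dvdn_aurifeuille_mul.
    rewrite /local_val pL p_lm logn_aurifeuille_mul // (logn_prime _ l_pr).
    by have -> : p == l by rewrite Dl.
  have p_lm : (p %| aurifeuille e (l * m))%N = false.
    apply/negP=> p_lm; move: (p_lm).
    rewrite dvdn_aurifeuille_div -/e' ?p_m // orderP.
    have := dvdn_exp2_12 p_pr lm_odd p_lm; rewrite orderP mulnCA Gauss_dvdr //.
    rewrite coprime_sym Dl prime_coprime // gtnNdvd //.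
    by case/andP: o_bounds.
  by rewrite !local_val0 // p_lm.
have -> : local_val (l :: L) e (l * m) = local_val L e (l * m).
  by rewrite /local_val inE eq_sym (negPf ne_lp).
case: ltnP => [lt_do|le_od] /=.
  rewrite mul1n (@local_val0 L e' m) //; apply/negP=> p_m.
  have := dvdn_exp2_12 p_pr m_odd p_m; rewrite orderP => o_m.
  have : (logn l o <= logn l (12 * m))%N by rewrite dvdn_leq_log // muln_gt0 m_gt0.
  by rewrite log_m leqNgt lt_do.
rewrite mul0n addn0.
case p_m : (p %| aurifeuille e' m)%N.
  rewrite /local_val p_m dvdn_aurifeuille_mul // logn_aurifeuille_mul //.
  by rewrite (logn_prime _ l_pr) eq_sym (negPf ne_lp) addn0.
rewrite !local_val0 //; apply/negP=> p_lm; move: (p_lm).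
rewrite dvdn_aurifeuille_div -/e' ?p_m // orderP.
apply: (dvdn_cancel_prime l_pr); rewrite ?log_m //; first by rewrite muln_gt0 m_gt0.
by have := dvdn_exp2_12 p_pr lm_odd p_lm; rewrite orderP mulnCA.
Qed.
End Valuation.

(** * Size of the Moebius product *)

(** This inequality and the next one make the bounds (y - 1) ^ D and (y + 1) ^ D
    reproduce themselves, with D (l - 1) for D, when a rational function P (y) is
    replaced by P (y ^ l) / P (y). *)
Lemma expr_subr1_ge (R : realFieldType) (y : R) l :
  1 <= y -> (1 < l)%N -> (y + 1) * (y - 1) ^+ l.-1 <= y ^+ l - 1.
Proof.
move=> y_ge1; elim: l => [|[|[|l]] IH] // _; first by rewrite expr1; nra.
have yl : 1 <= y ^+ l.+2 by apply: exprn_ege1.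
have {IH} := IH isT; rewrite /= [y ^+ l.+3]exprS [(y - 1) ^+ l.+2]exprS.
move: (y ^+ l.+2) yl ((y - 1) ^+ l.+1) => a a1 b IH; nra.
Qed.

Lemma expr_addr1_le (R : realFieldType) (y : R) l :
    1 <= y -> 2 <= y ^+ 2 -> (3 < l)%N ->
  y ^+ l + 1 <= (y - 1) * (y + 1) ^+ l.-1.
Proof.
move=> y_ge1 y2_ge2; elim: l => [|[|[|[|[|l]]]] IH] // _; first by move=> /=; nra.
have yl : 1 <= y ^+ l.+4 by apply: exprn_ege1.
have {IH} := IH isT; rewrite /= [y ^+ l.+4.+1]exprS [(y + 1) ^+ l.+4]exprS.
move: (y ^+ l.+4) yl ((y + 1) ^+ l.+3) => a a1 b IH; nra.
Qed.

(** The linear bound is chosen for ((l + 1) / 4) ^ 4 > l to hold from l = 5 on,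
    where both sides are close: 81 / 16 and 5. *)
Lemma expr_subr1_linear_ge (R : realFieldType) (y : R) l :
    1 <= y -> 2 <= y ^+ 2 -> (4 < l)%N ->
  l.+1%:R / 4 * (y + 1) <= y ^+ l - 1.
Proof.
move=> y_ge1 y2_ge2; elim: l => [|[|[|[|[|[|l]]]]] IH] // _.
  have -> : y ^+ 5 = (y ^+ 2) ^+ 2 * y by ring.
  have : 4 <= (y ^+ 2) ^+ 2 by nra.
  by move: ((y ^+ 2) ^+ 2) => z; nra.
have {IH} := IH isT; set k := l.+4.+1.
have yk : y ^+ 2 <= y ^+ k by apply: ler_weXn2l.
rewrite [y ^+ k.+1]exprS -[k.+2%:R]natr1; move: (y ^+ k) yk => a a1 H.
have : y + 1 <= 4 * (a * (y - 1)) by nra.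
nra.
Qed.

Section Size.
Variable R : rcfType.
Let s : R := Num.sqrt 2.

Lemma sqrt2_sqr : s ^+ 2 = 2.
Proof. by rewrite sqr_sqrtr. Qed.

Lemma sqrt2_bounds : 1 <= s <= 3 / 2.
Proof.
have s2 := sqrt2_sqr; have s_ge0 : 0 <= s by apply: sqrtr_ge0.
by apply/andP; split; nra.
Qed.

Lemma sqrt2_expr_ge d : (0 < d)%N -> 1 <= s ^+ d /\ 2 <= (s ^+ d) ^+ 2.
Proof.
case/andP: sqrt2_bounds => s1 _ d_gt0; split; first exact: exprn_ege1.
by rewrite exprAC sqrt2_sqr -natrX ler_nat -{1}(expn1 2) leq_exp2l.
Qed.

(** With y = sqrt 2 ^ d these are the bounds on the modulus of any product of
    four factors y - w with |w| = 1. *)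
Lemma aurifeuille_bounds e d : odd d ->
  (s ^+ d - 1) ^+ 4 <= (aurifeuille e d)%:R <= (s ^+ d + 1) ^+ 4.
Proof.
move=> d_odd; have d_gt0 : (0 < d)%N by case: d d_odd.
have [y1 y2] := sqrt2_expr_ge d_gt0; have /andP[s1 s2] := sqrt2_bounds.
rewrite aurifeuille_natr // /aurifeuille_form.
have -> : 2 ^+ d = (s ^+ d) ^+ 2 by rewrite exprAC sqrt2_sqr.
have -> : 2 ^+ uphalf d = s * s ^+ d.
  by rewrite -exprS -sqrt2_sqr -exprM; congr (_ ^+ _); lia.
move: (s ^+ d) y1 y2 => y y1 y2; case: e => /=.
  rewrite expr0 mul1r; apply/andP; split; rewrite -subr_ge0.
    rewrite (_ : _ - _ = y * ((4 + s) * (y ^+ 2 + 1) - 5 * y)); last by ring.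
    by apply: mulr_ge0; nra.
  rewrite (_ : _ - _ = y * ((4 - s) * (y ^+ 2 + 1) + 5 * y)); last by ring.
  by apply: mulr_ge0; nra.
rewrite expr1 mulN1r; apply/andP; split; rewrite -subr_ge0.
  rewrite (_ : _ - _ = y * ((4 - s) * (y ^+ 2 + 1) - 5 * y)); last by ring.
  by apply: mulr_ge0; nra.
rewrite (_ : _ - _ = y * ((4 + s) * (y ^+ 2 + 1) + 5 * y)); last by ring.
by apply: mulr_ge0; nra.
Qed.

Let deg (L : seq nat) : nat := (4 * \prod_(l <- L) l.-1)%N.
Let num L e d : R := (mobius_frac true L e d)%:R.
Let den L e d : R := (mobius_frac false L e d)%:R.

Let num_gt0 L e d : 0 < num L e d. Proof. by rewrite ltr0n mobius_frac_gt0. Qed.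
Let den_gt0 L e d : 0 < den L e d. Proof. by rewrite ltr0n mobius_frac_gt0. Qed.

Let bounded L e d :=
  (s ^+ d - 1) ^+ deg L * den L e d <= num L e d /\
  num L e d <= (s ^+ d + 1) ^+ deg L * den L e d.

Lemma mobius_frac_cons_ge L e l d (y := s ^+ d) : 1 <= y ->
    bounded L e (l * d) -> bounded L (e (+) two_nonresidue l) d ->
  (y ^+ l - 1) ^+ deg L * den (l :: L) e d <= (y + 1) ^+ deg L * num (l :: L) e d.
Proof.
move=> y1; rewrite /bounded -/y (_ : s ^+ (l * d) = y ^+ l); last by rewrite mulnC exprM.
move=> [lo _] [_ hi].
have yl : 1 <= y ^+ l by apply: exprn_ege1.
rewrite /den /num /= !natrM mulrA [X in _ <= X]mulrCA.
apply: ler_pM lo hi; last exact: ltW.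
by apply: mulr_ge0; [rewrite exprn_ge0 // subr_ge0 | apply: ltW].
Qed.

Lemma mobius_frac_cons_le L e l d (y := s ^+ d) : 1 <= y ->
    bounded L e (l * d) -> bounded L (e (+) two_nonresidue l) d ->
  (y - 1) ^+ deg L * num (l :: L) e d <= (y ^+ l + 1) ^+ deg L * den (l :: L) e d.
Proof.
move=> y1; rewrite /bounded -/y (_ : s ^+ (l * d) = y ^+ l); last by rewrite mulnC exprM.
move=> [_ hi] [lo _].
rewrite /den /num /= !natrM mulrCA [X in _ <= X]mulrA.
apply: ler_pM hi lo; first exact: ltW.
by apply: mulr_ge0; [rewrite exprn_ge0 // subr_ge0 | apply: ltW].
Qed.

(** In the passage from L to l :: L the common factor (y + 1) ^ D, respectively
    (y - 1) ^ D, of the two cross-multiplied inequalities is cancelled. *)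
Lemma mobius_frac_bounds L e d :
  all (fun l => odd l && (4 < l)%N) L -> odd d -> bounded L e d.
Proof.
elim: L e d => [|l L IH] e d /=.
  move=> _ d_odd; rewrite /bounded /deg /num /den big_nil /= !mulr1.
  by apply/andP; apply: aurifeuille_bounds.
case/andP=> /andP[l_odd l_gt4] oddL d_odd.
have d_gt0 : (0 < d)%N by case: d d_odd.
have [y1 y2] := sqrt2_expr_ge d_gt0.
have ld_odd : odd (l * d) by rewrite oddM l_odd.
have lo := mobius_frac_cons_ge y1 (IH e _ oddL ld_odd) (IH (e (+) _) _ oddL d_odd).
have hi := mobius_frac_cons_le y1 (IH e _ oddL ld_odd) (IH (e (+) _) _ oddL d_odd).
have degE : deg (l :: L) = (l.-1 * deg L)%N by rewrite /deg big_cons mulnCA.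
rewrite /bounded degE.
move: (s ^+ d) (deg L) y1 y2 lo hi => y D y1 y2 lo hi; rewrite !exprM.
have y_gt1 : 0 < y - 1 by nra.
have y_gt0 : 0 < y + 1 by lra.
split.
  rewrite -(ler_pM2l (exprn_gt0 D y_gt0)); apply: le_trans lo.
  rewrite mulrA -exprMn; apply: ler_wpM2r; first exact: ltW.
  apply: lerXn2r; rewrite ?nnegrE.
  - by rewrite mulr_ge0 ?exprn_ge0 ?ltW.
  - by rewrite subr_ge0 exprn_ege1.
  - exact: expr_subr1_ge (ltnW (ltnW (ltnW l_gt4))).
rewrite -(ler_pM2l (exprn_gt0 D y_gt1)); apply: (le_trans hi).
rewrite mulrA -exprMn; apply: ler_wpM2r; first exact: ltW.
apply: lerXn2r; rewrite ?nnegrE.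
- by rewrite addr_ge0 // exprn_ge0 //; lra.
- by rewrite mulr_ge0 ?exprn_ge0 ?ltW.
- exact: expr_addr1_le (ltnW l_gt4).
Qed.

(** Here y + 1 is not absorbed into a power of y - 1, which may be less than 1:
    the quotient of numerator by denominator is at least
    ((y ^ l - 1) / (y + 1)) ^ 4 >= ((l + 1) / 4) ^ 4 > l. *)
Lemma mobius_frac_gt L e l d :
    all (fun i => odd i && (4 < i)%N) (l :: L) -> odd d ->
  (l * mobius_frac false (l :: L) e d < mobius_frac true (l :: L) e d)%N.
Proof.
case/andP=> /andP[l_odd l_gt4] oddL d_odd.
have d_gt0 : (0 < d)%N by case: d d_odd.
have [y1 y2] := sqrt2_expr_ge d_gt0.
have ld_odd : odd (l * d) by rewrite oddM l_odd.
have := mobius_frac_cons_ge y1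
  (mobius_frac_bounds e oddL ld_odd) (mobius_frac_bounds (e (+) _) oddL d_odd).
rewrite -(ltr_nat R) natrM -/(num (l :: L) e d) -/(den (l :: L) e d).
move: (s ^+ d) y1 y2 => y y1 y2 lo.
have y_gt0 : 0 < y + 1 by lra.
have ge1 : 1 <= l.+1%:R / 4 :> R.
  by rewrite ler_pdivlMr // mul1r ler_nat; lia.
have deg_ge4 : (4 <= deg L)%N.
  rewrite leq_pmulr // big_seq.
  apply: (big_ind (fun m => 0 < m)%N) => // [m1 m2|i iL].
    by rewrite muln_gt0 => -> ->.
  by case/andP: (allP oddL _ iL); lia.
have step : l%:R < (l.+1%:R / 4) ^+ deg L :> R.
  apply: (@lt_le_trans _ _ ((l.+1%:R / 4) ^+ 4)); last exact: ler_weXn2l.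
  have : 5 <= l%:R :> R by rewrite ler_nat.
  rewrite -(natr1 l); move: (l%:R : R) => x x5.
  rewrite exprMn exprVn ltr_pdivlMr ?exprn_gt0 //.
  (* The tangent at x = 5 loses little enough for 256 x < (x + 1) ^ 4. *)
  have : 36 + 12 * (x - 5) <= (x + 1) ^+ 2 by nra.
  have -> : (x + 1) ^+ 4 = ((x + 1) ^+ 2) ^+ 2 by ring.
  by move: ((x + 1) ^+ 2) => z; nra.
apply: (@lt_le_trans _ _ ((l.+1%:R / 4) ^+ deg L * den (l :: L) e d)).
  by rewrite ltr_pM2r.
rewrite -(ler_pM2l (exprn_gt0 (deg L) y_gt0)); apply: le_trans lo.
rewrite mulrA -exprMn; apply: ler_wpM2r; first exact: ltW.
apply: lerXn2r; rewrite ?nnegrE.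
- by rewrite mulr_ge0 ?ltW // (lt_le_trans ltr01).
- by rewrite subr_ge0 exprn_ege1.
- by rewrite mulrC; apply: expr_subr1_linear_ge.
Qed.
End Size.

(** * Existence of primitive prime divisors *)

Lemma order2_is_ppd p m : prime p -> (0 < m)%N ->
  (forall k, (p %| 2 ^ k - 1)%N = (m %| k)%N) -> is_ppd 2 m p.
Proof.
move=> p_pr m_gt0 ordP; rewrite /is_ppd p_pr ordP dvdnn /=.
rewrite Euclid_dvd_prod // big_has_cond; apply/hasPn=> j.
rewrite mem_index_iota => /andP[j_gt0 j_lt]; rewrite /= ordP.
by rewrite gtnNdvd.
Qed.

(** The order o of 2 modulo p always contains the full powers of 2 and 3
    dividing 12 n, since q ^ 6 and q ^ 4 are not 1 modulo p for q = 2 ^ n; so a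
    proper divisor of 12 n can only miss a factor l > 3. *)
Lemma nonprimitive_prime_defect p o n e :
    prime p -> odd n -> (p %| aurifeuille e n)%N ->
    (forall k, (p %| 2 ^ k - 1)%N = (o %| k)%N) -> ~~ is_ppd 2 (12 * n) p ->
  exists l, [/\ prime l, (3 < l)%N, (l %| n)%N & (logn l o < logn l n)%N].
Proof.
move=> p_pr n_odd p_n ordP; have n_gt0 : (0 < n)%N by case: n n_odd {p_n}.
have n12_gt0 : (0 < 12 * n)%N by rewrite muln_gt0.
have o_12n : (o %| 12 * n)%N by rewrite -ordP (dvdn_exp2_12 p_pr n_odd p_n).
have o_6n : (o %| 6 * n)%N = false by rewrite -ordP (dvdn_exp2_6F p_pr n_odd p_n).
have o_4n : (o %| 4 * n)%N = false by rewrite -ordP (dvdn_exp2_4F p_pr n_odd p_n).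
have o_gt0 : (0 < o)%N := dvdn_gt0 n12_gt0 o_12n.
have [Do | ne_o] := eqVneq o (12 * n)%N.
  by rewrite order2_is_ppd // -Do.
move=> _; set l := pdiv (12 * n %/ o).
have c_gt1 : (1 < 12 * n %/ o)%N.
  rewrite ltn_neqAle eq_sym divn_gt0 // dvdn_leq // andbT.
  by apply: contra ne_o; rewrite eq_sym eqn_div // mul1n.
have l_pr : prime l by rewrite pdiv_prime.
have lo_12n : (l * o %| 12 * n)%N.
  by rewrite mulnC -[(12 * n)%N](divnK o_12n) mulnC dvdn_pmul2r // pdiv_dvd.
exists l; suff l_gt3 : (3 < l)%N.
  have l_12 : coprime l 12.
    rewrite prime_coprime // (Euclid_dvdM 3 4) // (Euclid_dvdM 2 2) //.
    by rewrite !gtnNdvd // (ltn_trans _ l_gt3).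
  have := dvdn_leq_log l n12_gt0 lo_12n.
  rewrite (lognM _ (prime_gt0 l_pr) o_gt0) logn_prime // eqxx logn_Gauss // => lt_o.
  split=> //; have : (l %| 12 * n)%N by apply: dvdn_trans lo_12n; apply: dvdn_mulr.
  by rewrite Gauss_dvdr.
rewrite ltnNge; apply/negP=> l_le3.
have [l2 | ne_l2] := eqVneq l 2%N.
  move: lo_12n; rewrite l2 (_ : 12 * n = 2 * (6 * n))%N; last by ring.
  by rewrite dvdn_pmul2l // o_6n.
have l3 : l = 3%N by have := prime_gt1 l_pr; lia.
move: lo_12n; rewrite l3 (_ : 12 * n = 3 * (4 * n))%N; last by ring.
by rewrite dvdn_pmul2l // o_4n.
Qed.

(** Put n = d * prod L. By [logn_mobius_frac] a prime p survives in the product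
    only if the order o of 2 modulo p contains the full powers dividing n of all
    primes of L but p. A non-primitive p has a defect at some prime of L, which
    must then be p itself, so that p survives to the first power only. If p were
    not l, then l would divide o, whence l <= o < p, against the choice of l. *)
Lemma mobius_frac_dvdn L e d l :
    uniq L -> all (fun i => prime i && (3 < i)%N) L -> odd d ->
    (forall i, prime i -> (3 < i)%N -> (i %| d * \prod_(j <- L) j)%N -> i \in L) ->
    l \in L -> {in L, forall i, (i <= l)%N} ->
    (forall p, (p %| aurifeuille e (d * \prod_(j <- L) j))%N ->
       ~~ is_ppd 2 (12 * (d * \prod_(j <- L) j)) p) ->
  (mobius_frac true L e d %| l * mobius_frac false L e d)%N.
Proof.
move=> uL prL d_odd Lall lL l_max nonprim.
have prL' : all prime L by apply: sub_all prL => i /andP[].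
have l_pr : prime l := allP prL' _ lL.
have d_gt0 : (0 < d)%N by case: (d) d_odd.
have oddL : all odd L by apply: sub_all prL => i; apply: prime_gt3_odd.
have P_gt0 := prod_primes_gt0 prL'; have P_odd := prod_odds_odd oddL.
set P := \prod_(i <- L) i in Lall nonprim P_gt0 P_odd *.
have n_odd : odd (d * P) by rewrite oddM d_odd.
have logn_n i : i \in L -> logn i (d * P) = (logn i d).+1.
  by move=> iL; rewrite lognM // logn_prod_primes // iL addn1.
apply: dvdn_logn => [||p p_pr]; rewrite ?muln_gt0 ?mobius_frac_gt0 ?(prime_gt0 l_pr) //.
have [-> | p_odd] := even_prime p_pr.
  by rewrite lognE dvdn2 odd_mobius_frac // !andbF.
have [o o_bounds ordP] := order2_exists p_pr p_odd.
rewrite (logn_mobius_frac p_pr o_bounds ordP) //.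
rewrite (lognM _ (prime_gt0 l_pr)) ?mobius_frac_gt0 // addnC leq_add2r.
rewrite (logn_prime p l_pr).
case: allP => [full|_] //; rewrite mul1n -/P.
case p_n : (p %| aurifeuille e (d * P))%N; last first.
  by case: ifP => // _; rewrite lognE p_n !andbF.
have [i [i_pr i_gt3 i_n lt_o]] :=
  nonprimitive_prime_defect p_pr n_odd p_n ordP (nonprim p p_n).
have iL := Lall i i_pr i_gt3 i_n.
have Di : i = p.
  apply/eqP; case/orP: (full i iL) => // lt_d.
  by move: lt_o; rewrite logn_n // ltnS leqNgt lt_d.
rewrite -{1}Di iL; have [//|ne_pl] := eqVneq p l.
have l_o : (l %| o)%N.
  case/orP: (full l lL) => [/eqP Dl|]; first by rewrite Dl eqxx in ne_pl.
  case: (posnP (logn l o)) => [->//|]; rewrite logn_gt0 mem_primes.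
  by case/and3P.
case/andP: o_bounds => o_gt0 o_lt.
have := l_max i iL; rewrite Di leqNgt.
by rewrite (leq_ltn_trans (dvdn_leq o_gt0 l_o) o_lt).
Qed.

Lemma aurifeuille_gt1 (e : bool) n : (0 < n)%N -> e || (3 <= n)%N ->
  (1 < aurifeuille e n)%N.
Proof.
move=> n_gt0; rewrite /aurifeuille; case: e => /= [_|n_ge3]; rewrite ltnS.
  by rewrite muln_gt0 addn_gt0 expn_gt0.
by rewrite muln_gt0 subn_gt0 ltn_exp2l //; lia.
Qed.

(** The field R supplies sqrt 2 to the size estimate. The list L is taken in
    decreasing order, so that its head, which the size estimate singles out, is
    the prime that may survive in the product. *)
Lemma aurifeuille_ppd (R : rcfType) (e : bool) n : odd n -> e || (3 <= n)%N ->
  exists p, is_ppd 2 (12 * n) p && (p %| aurifeuille e n)%N.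
Proof.
move=> n_odd e_n; have n_gt0 : (0 < n)%N by case: n n_odd {e_n}.
have [/hasP[p] | noppd] := boolP (has (is_ppd 2 (12 * n)) (primes (aurifeuille e n))).
  by rewrite mem_primes => /and3P[_ _ p_n] ppd; exists p; rewrite ppd.
have nonprim p : (p %| aurifeuille e n)%N -> ~~ is_ppd 2 (12 * n) p.
  move=> p_n; apply: contra noppd => ppd; apply/hasP; exists p => //.
  by rewrite mem_primes aurifeuille_gt0 p_n !andbT; case/and3P: ppd.
have [q q_pr q_n] : exists2 q, prime q & (q %| aurifeuille e n)%N.
  exists (pdiv (aurifeuille e n)); last exact: pdiv_dvd.
  by rewrite pdiv_prime // aurifeuille_gt1.
set L := rev [seq l <- primes n | (3 < l)%N].
have memL l : (l \in L) = [&& prime l, (3 < l)%N & (l %| n)%N].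
  by rewrite mem_rev mem_filter mem_primes n_gt0 /= andbCA.
have uL : uniq L by rewrite rev_uniq filter_uniq ?primes_uniq.
have prL : all (fun i => prime i && (3 < i)%N) L.
  by apply/allP=> i; rewrite memL => /and3P[-> ->].
have prL' : all prime L by apply: sub_all prL => i /andP[].
have P_gt0 := prod_primes_gt0 prL'.
have P_n : (\prod_(i <- L) i %| n)%N.
  apply: dvdn_logn => // l l_pr; rewrite logn_prod_primes // memL l_pr /=.
  by case: andP => // -[_ l_n]; rewrite logn_gt0 mem_primes l_pr n_gt0.
set d := (n %/ \prod_(i <- L) i)%N.
have Dn : (d * \prod_(i <- L) i)%N = n by rewrite divnK.
have d_odd : odd d by move: n_odd; rewrite -Dn oddM => /andP[].
have sL : sorted (fun x y => y < x)%N L.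
  by rewrite rev_sorted sorted_filter ?sorted_primes //; apply: ltn_trans.
have [l Ll l_max] : exists2 l, ohead L = Some l & {in L, forall i, (i <= l)%N}.
  have [o o_bounds ordP] := order2_exists q_pr (aurifeuille_p_odd n_odd q_n).
  have [i [i_pr i_gt3 i_n _]] :=
    nonprimitive_prime_defect q_pr n_odd q_n ordP (nonprim q q_n).
  have : i \in L by rewrite memL i_pr i_gt3.
  case: (L) sL => // l L' /= sL' _; exists l => // j.
  rewrite inE => /predU1P[->//|jL'].
  apply: ltnW; apply: (allP (order_path_min _ sL')) => //.
  by move=> x y z yx /ltn_trans; apply.
have lL : l \in L by case: (L) Ll => // x L' [->]; rewrite mem_head.
have dvd : (mobius_frac true L e d %| l * mobius_frac false L e d)%N.
  apply: mobius_frac_dvdn; rewrite ?Dn // => i i_pr i_gt3 i_n.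
  by rewrite memL i_pr i_gt3.
have /dvdn_leq := dvd.
rewrite muln_gt0 mobius_frac_gt0 andbT prime_gt0 ?(allP prL') // => /(_ isT).
rewrite leqNgt => /negP[].
have oddL : all (fun i => odd i && (4 < i)%N) L.
  apply: sub_all prL => i i_pr; have i_odd := prime_gt3_odd i_pr.
  case/andP: i_pr => _ i_gt3; rewrite i_odd /=.
  by case: (ltngtP 4 i) i_gt3 i_odd => // <-.
move: Ll oddL; case: (L) => // x L' [->] oddL.
exact: (mobius_frac_gt R).
Qed.

Theorem corollary3p5 (R : rcfType) (n q : nat)
    (n_ge1 : (1 <= n)%N) (n_odd : odd n) (q_def : q = (2 ^ n)%N) :
  ((3 <= n)%N ->
    exists p : nat,
      [/\ is_ppd 2 (12 * n) p,
          (p %| q%:Z ^+ 4 - q%:Z ^+ 2 + 1)%Z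
        & dvd_as_int p (Phi24'' R q)])
  /\
  (exists p : nat,
      [/\ is_ppd 2 (12 * n) p,
          (p %| q%:Z ^+ 4 - q%:Z ^+ 2 + 1)%Z
        & dvd_as_int p (Phi24' R q)]).
Proof.
have D : q%:Z ^+ 4 - q%:Z ^+ 2 + 1 =
    (aurifeuille true n)%:Z * (aurifeuille false n)%:Z.
  rewrite -!natz !aurifeuille_natr // (aurifeuille_form_mul true) ?sqr_exp2_uphalf //.
  by rewrite q_def natrX.
have Dr : Num.sqrt (2 * q%:R) = 2 ^+ uphalf n :> R.
  by rewrite q_def natrX -sqr_exp2_uphalf // sqrtr_sqr ger0_norm ?exprn_ge0.
split=> [n_ge3|].
  have [p /andP[ppd p_n]] := aurifeuille_ppd R n_odd (n_ge3 : false || (3 <= n)%N).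
  exists p; split=> //; first by rewrite D dvdz_mull.
  exists (aurifeuille false n)%:Z; last by [].
  rewrite /Phi24'' Dr -pmulrn aurifeuille_natr // /aurifeuille_form q_def natrX /=.
  ring.
have [p /andP[ppd p_n]] := aurifeuille_ppd R n_odd (isT : true || (3 <= n)%N).
exists p; split=> //; first by rewrite D dvdz_mulr.
exists (aurifeuille true n)%:Z; last by [].
rewrite /Phi24' Dr -pmulrn aurifeuille_natr // /aurifeuille_form q_def natrX /=.
ring.
Qed.
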